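(* Let $N\ge 3$ and let $a_1,\dots,a_N\in\mathbb{C}$ with $\sum_{i=1}^N|a_i|^2=1$. Let $$|W_N\rangle_g=\sum_{i=1}^{N}a_i\,|0\rangle^{\otimes(i-1)}|1\rangle_i|0\rangle^{\otimes(N-i)}\in(\mathbb{C}^2)^{\otimes N}$$ be the corresponding $N$-qubit generalized W state. Then, for measurement on a single qubit $r$, $$E_L^r(|W_N\rangle_g)\ge\mathcal{G}(|W_N\rangle_g)\qquad\text{for all } r\in\{1,\dots,N\}.$$
   Context: Generalized geometric measure (GGM): for a unit vector $|\psi\rangle\in(\mathbb{C}^2)^{\otimes n}$, $n\ge 2$, $$\mathcal{G}(|\psi\rangle)=1-\max_{\mathcal{A}:\mathcal{B}}\lambda^2_{\mathcal{A}:\mathcal{B}},$$ where the maximum is over all bipartitions of $\{1,\dots,n\}$ into nonempty disjoint sets $\mathcal{A},\mathcal{B}$ with $\mathcal A\cup\mathcal B=\{1,\dots,n\}$, and $\lambda_{\mathcal{A}:\mathcal{B}}$ is the largest Schmidt coefficient of $|\psi\rangle$ across $\mathcal{A}:\mathcal{B}$. Localizable generalized geometric measure (LGGM) of an $N$-qubit unit vector $|\Phi\rangle$ with a single measured qubit $r\in\{1,\dots,N\}$, $N\ge3$: for an orthonormal basis $\{|\xi^1\rangle,|\xi^2\rangle\}$ of the space $\mathbb{C}^2$ of qubit $r$, let $\Pi^l=|\xi^l\rangle\langle\xi^l|\otimes\mathbb{I}_{N-1}$ (acting on qubit $r$ in the first factor), $p^l=\langle\Phi|\Pi^l|\Phi\rangle$,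 and, if $p^l>0$, let $|\psi^l_{N-1}\rangle$ be the unit vector of the other $N-1$ qubits with $\Pi^l|\Phi\rangle/\sqrt{p^l}=|\xi^l\rangle\otimes|\psi^l_{N-1}\rangle$. Then $$E_L^r(|\Phi\rangle)=\sup\sum_{l=1}^2p^l\,\mathcal{G}(|\psi^l_{N-1}\rangle),$$ the supremum being over all orthonormal bases of qubit $r$ (outcomes with $p^l=0$ contribute $0$). *)

(* Defs.v *)
From HB Require Import structures.
From mathcomp Require Import all_boot all_order all_algebra.
From mathcomp Require Import all_classical all_reals.
From mathcomp Require Export complex.

Set Implicit Arguments.
Unset Strict Implicit.
Unset Printing Implicit Defensive.

Import Order.TTheory GRing.Theory Num.Theory.
Local Open Scope ring_scope.

(* R : realType is the field of real numbers and R[i] that of complex numbers.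

   Vectors are given by their coordinates: [vec R I] is C^I with its standard
   basis indexed by I.  The basis vectors |0>, |1> of C^2 are indexed by false
   and true, and a system of qubits labelled by a finite type T has as
   computational basis the labellings x : T -> bool, so that (C^2)^{(x) n} is
   [qubits R 'I_n].  Arbitrary finite label types are needed for subsystems. *)

Definition vec (R : realType) (I : finType) : Type := {ffun I -> R[i]}.

Definition qubit (R : realType) : Type := vec R bool.

Definition qubits (R : realType) (T : finType) : Type :=
  vec R {ffun T -> bool}.

Section Hilbert.
Variables (R : realType) (I : finType).

Definition braket (u v : vec R I) : R[i] := \sum_(x : I) (u x)^* * v x.

Definition unit_vector (u : vec R I) : Prop := braket u u = 1.

Definition orthonormal_family (m : nat) (u : 'I_m -> vec R I) : Prop :=
  forall k l : 'I_m, braket (u k) (u l) = (k == l)%:R.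

End Hilbert.

Section GGM.
Variables (R : realType) (T : finType).

Definition restrict (P : pred T) (x : {ffun T -> bool}) :
  {ffun {i : T | P i} -> bool} := [ffun j => x (val j)].

(* A Schmidt decomposition psi = \sum_k lam_k u_k (x) v_k across the
   bipartition of T into A and its complement. *)
Definition schmidt_decomposition (A : {set T}) (psi : qubits R T) (m : nat)
    (lam : 'I_m -> R)
    (u : 'I_m -> qubits R {i : T | i \in A})
    (v : 'I_m -> qubits R {i : T | i \notin A}) : Prop :=
  [/\ forall k, 0 <= lam k,
      orthonormal_family u,
      orthonormal_family v
    & forall x : {ffun T -> bool},
        psi x = \sum_(k < m) real_complex R (lam k) *
          (u k (restrict (fun i => i \in A) x) *
           v k (restrict (fun i => i \notin A) x))].

Definition schmidt_coefficient (A : {set T}) (psi : qubits R T) (c : R) : Prop :=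
  exists (m : nat) (lam : 'I_m -> R)
    (u : 'I_m -> qubits R {i : T | i \in A})
    (v : 'I_m -> qubits R {i : T | i \notin A}),
    schmidt_decomposition psi lam u v /\ exists k, lam k = c.

(* The set of Schmidt coefficients is finite and nonempty when psi != 0, so
   this supremum is a maximum. *)
Definition largest_schmidt (A : {set T}) (psi : qubits R T) : R :=
  sup [set c : R | schmidt_coefficient A psi c]%classic.

(* The default value 0 of the maximum plays no role when #|T| >= 2: the squares
   are nonnegative and there is at least one bipartition. *)
Definition GGM (psi : qubits R T) : R :=
  1 - \big[Num.max/0]_(A : {set T} | (A != finset.set0) && (A != finset.setT))
        largest_schmidt A psi ^+ 2.

End GGM.

Section LGGM.
Variables (R : realType) (T : finType) (r : T).

Definition set_qubit (x : {ffun T -> bool}) (b : bool) : {ffun T -> bool} :=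
  [ffun i => if i == r then b else x i].

(* (|xi><xi| (x) I) Phi, with |xi><xi| acting on qubit r. *)
Definition project (xi : qubit R) (Phi : qubits R T) : qubits R T :=
  [ffun x : {ffun _ -> bool} => \sum_(b : bool) (xi (x r) * (xi b)^*) * Phi (set_qubit x b)].

(* braket Phi (project xi Phi) is real, as project xi is self-adjoint. *)
Definition outcome_prob (xi : qubit R) (Phi : qubits R T) : R :=
  complex.Re (braket Phi (project xi Phi)).

(* xi (x) psi, with xi the state of qubit r and psi that of the others. *)
Definition tensor_at (xi : qubit R) (psi : qubits R {i : T | i != r}) :
  qubits R T := [ffun x : {ffun _ -> bool} => xi (x r) * psi (restrict (fun i => i != r) x)].

(* For xi a unit vector and positive probability, there is exactly one such
   psi. *)
Definition post_measurement (xi : qubit R) (Phi : qubits R T)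
    (psi : qubits R {i : T | i != r}) : Prop :=
  unit_vector psi /\
  forall x, project xi Phi x / real_complex R (Num.sqrt (outcome_prob xi Phi))
            = tensor_at xi psi x.

(* The values of \sum_l p^l G(psi^l) over the orthonormal bases (xi_0, xi_1) of
   C^2; two orthonormal vectors of C^2 form a basis.  When p^l = 0 the vector
   psi_l is unconstrained, but its term vanishes. *)
Definition measurement_averages (Phi : qubits R T) : set R :=
  [set e : R | exists (xi : 'I_2 -> qubit R)
                      (psi : 'I_2 -> qubits R {i : T | i != r}),
    [/\ orthonormal_family xi,
        forall l, 0 < outcome_prob (xi l) Phi ->
          post_measurement (xi l) Phi (psi l)
      & e = \sum_(l < 2) outcome_prob (xi l) Phi * GGM (psi l)]]%classic.

(* For a unit vector Phi the set is nonempty and contained in [0, 1], so the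
   real supremum is the intended one. *)
Definition LGGM (Phi : qubits R T) : R := sup (measurement_averages Phi).

End LGGM.

Definition basis_state (R : realType) (T : finType) (y : {ffun T -> bool}) :
  qubits R T := [ffun x : {ffun _ -> bool} => (x == y)%:R].

(* |0...0 1_i 0...0> has label j |-> (j == i). *)
Definition generalized_W (R : realType) (N : nat) (a : 'I_N -> R[i]) :
  qubits R 'I_N :=
  [ffun x : {ffun _ -> bool} => \sum_(i < N) a i * basis_state R [ffun j => j == i] x].

(* Main.v *)
(** Both sides reduce to the moduli of the amplitudes.  Across A : B a
    generalized W state is |W_A>|0_B> + |0_A>|W_B>, where |W_A> and |W_B> have
    squared norms s_A and s_B and are orthogonal to |0_A> and |0_B>.  Its
    squared Schmidt coefficients are thus s_A and s_B = 1 - s_A, so that its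
    GGM is the minimum of the |a_i|^2.  Measuring qubit r in the computational
    basis, outcome 0 has probability p = 1 - |a_r|^2 and leaves the generalized
    W state with amplitudes a_i / sqrt p, i <> r.  It contributes
    p * min_{i <> r} |a_i|^2 / p, which is at least the original GGM, while
    outcome 1 contributes a nonnegative amount. *)

From mathcomp Require Import all_boot all_order all_algebra.
From mathcomp Require Import all_classical all_reals.
From mathcomp Require Import ring lra.
(* Imported last: mathcomp-classical also has a [restrict]. *)
Require Import Defs.
Import Order.TTheory GRing.Theory Num.Theory.
Set Implicit Arguments.
Unset Strict Implicit.
Unset Printing Implicit Defensive.
Local Open Scope ring_scope.

Local Notation "x %:C" := (real_complex _ x) : ring_scope.

(** * Squared norms, and AM-GM for moduli *)

Lemma braketE (R : realType) (I : finType) (u : vec R I) :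
  braket u u = \sum_x `|u x| ^+ 2.
Proof. by apply: eq_bigr => x _; rewrite normCKC. Qed.

Lemma unit_vectorP (R : realType) (I : finType) (u : vec R I) :
  unit_vector u <-> \sum_x `|u x| ^+ 2 = 1.
Proof. by rewrite /unit_vector braketE. Qed.

Lemma orthonormal_unit (R : realType) (I : finType) (m : nat)
    (u : 'I_m -> vec R I) (k : 'I_m) :
  orthonormal_family u -> \sum_x `|u k x| ^+ 2 = 1.
Proof. by move=> uo; apply/unit_vectorP; rewrite /unit_vector uo eqxx. Qed.

(** Expand [(|x| |y| - |z|) ^ 2 >= 0]. Summed over basis labels, this takes the place of
    Cauchy-Schwarz for overlaps with product vectors. *)
Lemma ler_MM_norm2 (C : numClosedFieldType) (x y z : C) :
  `|x * y * z| *+ 2 <= `|x| ^+ 2 * `|y| ^+ 2 + `|z| ^+ 2.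
Proof.
rewrite !normrM -exprMn -subr_ge0.
have -> : (`|x| * `|y|) ^+ 2 + `|z| ^+ 2 - `|x| * `|y| * `|z| *+ 2
          = (`|x| * `|y| - `|z|) ^+ 2 by ring.
by rewrite real_exprn_even_ge0 // rpredB // ?rpredM // normr_real.
Qed.

(** * Schmidt coefficients across a bipartition, and bounds on the GGM *)

Section Bipartition.
Variables (R : realType) (T : finType).
Implicit Types (A : {set T}) (psi : qubits R T).

Lemma restrict_inj A (x y : {ffun T -> bool}) :
  restrict (fun i => i \in A) x = restrict (fun i => i \in A) y ->
  restrict (fun i => i \notin A) x = restrict (fun i => i \notin A) y ->
  x = y.
Proof.
move=> /ffunP eA /ffunP eB; apply/ffunP => i.
have [iA|iA] := boolP (i \in A).
  by have := eA (exist _ i iA); rewrite !ffunE.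
by have := eB (exist _ i iA); rewrite !ffunE.
Qed.

(** Restricting to [A] and to its complement is injective into a set of pairs of the same
    cardinality, hence bijective, so the double sum can be reindexed. *)
Lemma sum_restrict A (f : {ffun {i : T | i \in A} -> bool} -> R[i])
    (g : {ffun {i : T | i \notin A} -> bool} -> R[i]) :
  \sum_x f (restrict (fun i => i \in A) x) * g (restrict (fun i => i \notin A) x)
  = (\sum_y f y) * (\sum_z g z).
Proof.
rewrite big_distrlr pair_big /=.
pose h (x : {ffun T -> bool}) :=
  (restrict (fun i => i \in A) x, restrict (fun i => i \notin A) x).
rewrite [RHS](reindex h) //; apply: onW_bij; apply: inj_card_bij.
  by move=> x y [] /restrict_inj; apply.
rewrite card_prod !card_ffun !card_sig card_bool -expnD.
by rewrite -(cardC (mem A)).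
Qed.

(** Expanding [psi] in the overlap of [u k] (x) [v k] with [psi], orthonormality leaves only the
    term [k]. Every upper bound on Schmidt coefficients below is a bound on such an overlap. *)
Lemma schmidt_overlap A psi m (lam : 'I_m -> R) u v (k : 'I_m) :
  schmidt_decomposition (A := A) psi lam u v ->
  (lam k)%:C = \sum_x (u k (restrict (fun i => i \in A) x))^* *
                      (v k (restrict (fun i => i \notin A) x))^* * psi x.
Proof.
case=> _ uo vo psiE.
transitivity (\sum_l (lam l)%:C * (braket (u k) (u l) * braket (v k) (v l))).
  rewrite (bigD1 k) //= uo vo eqxx !mulr1 big1 ?addr0 // => l lk.
  by rewrite uo eq_sym (negPf lk) mul0r mulr0.
under [RHS]eq_bigr => x _ do rewrite psiE mulr_sumr.
rewrite exchange_big; apply: eq_bigr => l _ /=.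
rewrite /braket -sum_restrict mulr_sumr; apply: eq_bigr => x _; ring.
Qed.

(** By AM-GM on each label, twice the overlap is at most the squared norm of [u k] (x) [v k] plus
    that of [psi], which is 2. This also bounds the set whose supremum is [largest_schmidt]. *)
Lemma schmidt_coefficient_le1 A psi c :
  unit_vector psi -> schmidt_coefficient A psi c -> 0 <= c <= 1.
Proof.
move=> /unit_vectorP psi1 [m [lam [u [v [sd [k <-]]]]]].
have [lam0 uo vo _] := sd; rewrite lam0 /= -lecR.
have lamr : `|(lam k)%:C| = (lam k)%:C by rewrite ger0_norm // ler0c.
rewrite -(ler_pMn2r (n := 2)) // -lamr (schmidt_overlap k sd).
have -> : 1%:C *+ 2 = \sum_x (`|u k (restrict (fun i => i \in A) x)| ^+ 2 *
    `|v k (restrict (fun i => i \notin A) x)| ^+ 2 + `|psi x| ^+ 2) :> R[i].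
  rewrite big_split /= psi1 (sum_restrict (fun y => `|u k y| ^+ 2)
    (fun z => `|v k z| ^+ 2)) !orthonormal_unit // mulr1 rmorph1; ring.
apply: (@le_trans _ _ (\sum_x `|(u k (restrict (fun i => i \in A) x))^* *
                      (v k (restrict (fun i => i \notin A) x))^* * psi x| *+ 2)).
  by rewrite sumrMnl lerMn2r ler_norm_sum.
apply: ler_sum => x _; apply: le_trans (ler_MM_norm2 _ _ _) _.
by rewrite !norm_conjC.
Qed.

Lemma largest_schmidt_ge A psi c :
  unit_vector psi -> schmidt_coefficient A psi c -> c <= largest_schmidt A psi.
Proof.
move=> psi1 cA; apply: ub_le_sup => //.
by exists 1 => d /(schmidt_coefficient_le1 psi1) /andP[].
Qed.

(** The real [sup] is 0 on an empty or unbounded set; otherwise it dominates some nonnegative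
    coefficient. *)
Lemma largest_schmidt_ge0 A psi : 0 <= largest_schmidt A psi.
Proof.
rewrite /largest_schmidt; set S := [set c | _]%classic.
have S0 c : S c -> 0 <= c by move=> [m [lam [u [v [[lam0 _ _ _] [k <-]]]]]].
have [S1|/nonemptyPn ->] := pselect (S !=set0)%classic; last by rewrite sup0.
have [uS|nS] := pselect (has_ubound S); last by rewrite sup_out // => -[].
by have [c Sc] := S1; apply: le_trans (S0 _ Sc) (ub_le_sup uS Sc).
Qed.

Lemma largest_schmidt_le A psi b : 0 <= b ->
  (forall c, 0 <= c -> schmidt_coefficient A psi c -> c ^+ 2 <= b) ->
  largest_schmidt A psi ^+ 2 <= b.
Proof.
(* If the set of coefficients is empty, its supremum is 0 and [0 <= b] suffices. *)
move=> b0 cb; have [S1|/nonemptyPn S0] :=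
    pselect ([set c | schmidt_coefficient A psi c] !=set0)%classic; last first.
  by rewrite /largest_schmidt S0 sup0 expr0n.
rewrite -(sqr_sqrtr b0) ler_pXn2r ?nnegrE ?largest_schmidt_ge0 ?sqrtr_ge0 //.
apply: ge_sup => // c cA.
have c0 : 0 <= c by case: cA => [m [lam [u [v [[lam0 _ _ _] [k <-]]]]]].
by rewrite -(ler_pXn2r (n := 2)) ?nnegrE ?sqrtr_ge0 // sqr_sqrtr // cb.
Qed.

Lemma GGM_le1 psi : GGM psi <= 1.
Proof. by rewrite /GGM gerBl bigmax_ge_id. Qed.

Lemma GGM_le A psi : A != finset.set0 -> A != finset.setT ->
  GGM psi <= 1 - largest_schmidt A psi ^+ 2.
Proof.
move=> A0 AT; rewrite /GGM lerB //.
by apply: (@le_bigmax_cond _ _ _ _ A) => //; rewrite A0.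
Qed.

(** The hypothesis [b <= 1] makes [1 - b] an upper bound for the default value 0 of the maximum. *)
Lemma GGM_ge psi b : b <= 1 ->
  (forall A, A != finset.set0 -> A != finset.setT ->
     forall c, 0 <= c -> schmidt_coefficient A psi c -> c ^+ 2 <= 1 - b) ->
  b <= GGM psi.
Proof.
move=> b1 cb; rewrite /GGM lerBrDl -lerBrDr; apply: bigmax_le.
  by rewrite subr_ge0.
move=> A /andP[A0 AT]; apply: largest_schmidt_le; first by rewrite subr_ge0.
exact: cb.
Qed.

Lemma GGM_ge0 psi : unit_vector psi -> 0 <= GGM psi.
Proof.
move=> psi1; apply: GGM_ge => // A _ _ c c0 /(schmidt_coefficient_le1 psi1).
by rewrite subr0 c0 /= => c1; rewrite expr_le1.
Qed.

End Bipartition.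

(** * W states over arbitrary labels, and an upper bound on their Schmidt coefficients *)

Section WState.
Variables (R : realType) (T : finType).
Implicit Types (A : {set T}) (P : pred T) (a : T -> R[i]).

Definition vacuum : {ffun T -> bool} := [ffun=> false].
Definition excited (i : T) : {ffun T -> bool} := [ffun j => j == i].

(* Unlike [generalized_W], this covers the label type [{i | i != r}] of the
   qubits that remain after the measurement. *)
Definition W_state a : qubits R T :=
  [ffun x : {ffun _ -> bool} => \sum_i a i * basis_state R (excited i) x].

Lemma restrict_excited_notin P i :
  ~~ P i -> restrict P (excited i) = restrict P vacuum.
Proof.
move=> Pi; apply/ffunP => -[j Pj]; rewrite !ffunE /=.
by apply: contraNF Pi => /eqP <-.
Qed.

Lemma restrict_excited_inj P :
  {in P &, injective (fun i => restrict P (excited i))}.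
Proof.
move=> i j Pi _ /ffunP /(_ (exist _ i Pi)).
by rewrite !ffunE /= eqxx => /esym/eqP.
Qed.

Lemma restrict_excited_neq_vacuum P i :
  P i -> restrict P (excited i) != restrict P vacuum.
Proof.
move=> Pi; apply/eqP => /ffunP /(_ (exist _ i Pi)).
by rewrite !ffunE /= eqxx.
Qed.

Lemma excited_inj : injective excited.
Proof. by move=> i j /ffunP /(_ i); rewrite !ffunE eqxx => /esym/eqP. Qed.

(** The restricted vacuum and the restricted excitations at labels in [P] are pairwise distinct
    basis labels, so the left side is a partial sum of the squared norm. *)
Lemma unit_vector_weight_le1 P (u : qubits R {i : T | P i}) :
  \sum_y `|u y| ^+ 2 = 1 ->
  `|u (restrict P vacuum)| ^+ 2 +
    \sum_(i | P i) `|u (restrict P (excited i))| ^+ 2 <= 1.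
Proof.
move=> u1; rewrite -u1 (bigD1 (restrict P vacuum)) //= lerD2l.
rewrite -(big_imset (fun y => `|u y| ^+ 2) (@restrict_excited_inj P)) /=.
rewrite [leRHS](bigID (mem [set restrict P (excited x) | x in P])) /=.
rewrite (eq_bigl (fun y => (y != restrict P vacuum) &&
  (y \in [set restrict P (excited x) | x in P]))); last first.
  move=> y /=; case: imsetP => [[i Pi ->]|]; rewrite ?andbF //.
  by rewrite restrict_excited_neq_vacuum.
by rewrite lerDl sumr_ge0 // => y _; rewrite exprn_ge0.
Qed.

(** Pythagoras for distinct basis vectors. The map [h] is either [excited] or its restriction to one
    side of a bipartition. *)
Lemma sum_norm_basis_state (S : finType) (h : T -> {ffun S -> bool}) P a :
  {in P &, injective h} ->
  \sum_y `|\sum_(i | P i) a i * basis_state R (h i) y| ^+ 2 =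
  \sum_(i | P i) `|a i| ^+ 2.
Proof.
move=> hI; rewrite (bigID (mem [set h x | x in P])) /= [X in _ + X]big1 ?addr0.
  rewrite big_imset //=; apply: eq_bigr => i Pi.
  rewrite (bigD1 i) //= ffunE eqxx mulr1 big1 ?addr0 // => j /andP[Pj ji].
  by rewrite ffunE (inj_in_eq hI) // eq_sym (negPf ji) mulr0.
move=> y yh; rewrite big1 ?normr0 ?expr0n // => i Pi.
rewrite ffunE; case: eqP yh => [->|]; last by rewrite mulr0.
by rewrite imset_f.
Qed.

Lemma sum_mul_W_state a (f : {ffun T -> bool} -> R[i]) :
  \sum_x f x * W_state a x = \sum_i f (excited i) * a i.
Proof.
under eq_bigr => x _ do rewrite ffunE mulr_sumr.
rewrite exchange_big; apply: eq_bigr => i _ /=.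
rewrite (bigD1 (excited i)) //= ffunE eqxx mulr1 big1 ?addr0 // => x xi.
by rewrite ffunE (negPf xi) !mulr0.
Qed.

Lemma sum_norm_W_state a :
  \sum_x `|W_state a x| ^+ 2 = \sum_i `|a i| ^+ 2.
Proof.
rewrite -(@sum_norm_basis_state T excited predT a) /=; last first.
  by move=> i j _ _; apply: excited_inj.
by apply: eq_bigr => x _; rewrite ffunE.
Qed.

(** The overlap giving [c] involves only single excitations. An excitation in [A] leaves the other
    side in the vacuum, so [v] enters through [v0] alone, and symmetrically [u] through [u0]. AM-GM
    with weight [M = sqrt b] then separates the amplitudes from the Schmidt vectors. *)
Lemma schmidt_coefficient_W_state_le A a c (b : R) : 0 <= c ->
  schmidt_coefficient A (W_state a) c ->
  \sum_(i in A) `|a i| ^+ 2 <= b%:C -> \sum_(i | i \notin A) `|a i| ^+ 2 <= b%:C ->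
  0 < b -> c ^+ 2 <= b.
Proof.
move=> c0 [m [lam [u [v [sd [k ck]]]]]] sA sB b0.
have [_ uo vo _] := sd.
set M := Num.sqrt b; have M0 : 0 < M by rewrite sqrtr_gt0.
have bE : b%:C = M%:C ^+ 2 by rewrite -rmorphXn /= sqr_sqrtr // ltW.
suff cM : c <= M by rewrite -(sqr_sqrtr (ltW b0)) ler_pXn2r ?nnegrE // ltW.
pose pA := restrict (fun i => i \in A); pose pB := restrict (fun i => i \notin A).
pose uA i := u k (pA (excited i)); pose vB i := v k (pB (excited i)).
set u0 := u k (pA vacuum); set v0 := v k (pB vacuum).
have uA1 : `|u0| ^+ 2 + \sum_(i in A) `|uA i| ^+ 2 <= 1.
  exact/unit_vector_weight_le1/orthonormal_unit.
have vB1 : `|v0| ^+ 2 + \sum_(i | i \notin A) `|vB i| ^+ 2 <= 1.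
  exact/unit_vector_weight_le1/orthonormal_unit.
have cE : c%:C = \sum_i (uA i)^* * (vB i)^* * a i.
  by rewrite -ck (schmidt_overlap k sd) sum_mul_W_state.
have MC0 : 0 <= M%:C by rewrite ler0c ltW.
have termA i : i \in A -> `|M%:C * ((uA i)^* * (vB i)^* * a i)| *+ 2 <=
    `|a i| ^+ 2 * `|v0| ^+ 2 + M%:C ^+ 2 * `|uA i| ^+ 2.
  move=> iA; have -> : vB i = v0.
    by rewrite /vB /pB restrict_excited_notin ?negbK.
  have := ler_MM_norm2 (a i) (v0^*) (M%:C * (uA i)^*).
  rewrite !normrM !norm_conjC exprMn (ger0_norm MC0).
  by move=> H; apply: (le_trans _ H); rewrite ler_pMn2r // le_eqVlt; apply/orP; left; apply/eqP; ring.
have termB i : i \notin A -> `|M%:C * ((uA i)^* * (vB i)^* * a i)| *+ 2 <=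
    `|a i| ^+ 2 * `|u0| ^+ 2 + M%:C ^+ 2 * `|vB i| ^+ 2.
  move=> iA; have -> : uA i = u0.
    by rewrite /uA /pA restrict_excited_notin.
  have := ler_MM_norm2 (a i) (u0^*) (M%:C * (vB i)^*).
  rewrite !normrM !norm_conjC exprMn (ger0_norm MC0).
  by move=> H; apply: (le_trans _ H); rewrite ler_pMn2r // le_eqVlt; apply/orP; left; apply/eqP; ring.
(* Prove 2 M c <= 2 M ^ 2, bounding the overlap c term by term with AM-GM. *)
rewrite -(ler_pM2l M0) -(ler_pMn2r (n := 2)) // -lecR !rmorphMn !rmorphM /=.
have -> : M%:C * c%:C = `|M%:C * c%:C| by rewrite ger0_norm // mulr_ge0 ?ler0c // ltW.
rewrite cE mulr_sumr.
apply: le_trans (_ : (\sum_i `|M%:C * ((uA i)^* * (vB i)^* * a i)|) *+ 2 <= _).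
  by rewrite lerMn2r ler_norm_sum.
rewrite -sumrMnl (bigID (mem A)) /=.
apply: le_trans (lerD (ler_sum _ termA) (ler_sum _ termB)) _.
rewrite !big_split /= -!mulr_suml -!mulr_sumr.
set X := \sum_(i in A) `|uA i| ^+ 2 in uA1 *.
set Y := \sum_(i | i \notin A) `|vB i| ^+ 2 in vB1 *.
have MM : 0 <= M%:C ^+ 2 by rewrite exprn_ge0 // ler0c ltW.
rewrite bE in sA sB.
(* After replacing both amplitude sums by [M ^ 2], the four terms regroup as [M ^ 2] times the
   weights of [u k] and [v k], each at most 1. *)
have h1 := ler_wpM2r (exprn_ge0 2 (normr_ge0 v0)) sA.
have h2 := ler_wpM2r (exprn_ge0 2 (normr_ge0 u0)) sB.
have h3 := ler_wpM2l MM uA1; have h4 := ler_wpM2l MM vB1.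
apply: le_trans (lerD (lerD h1 (lexx _)) (lerD h2 (lexx _))) _.
have -> : M%:C * M%:C *+ 2 = M%:C ^+ 2 * 1 + M%:C ^+ 2 * 1 by ring.
by apply: (le_trans _ (lerD h3 h4)); rewrite le_eqVlt; apply/orP; left; apply/eqP; ring.
Qed.

End WState.

(** * The GGM of a W state in terms of the squared moduli of its amplitudes *)

Lemma orthonormal_pair (R : realType) (I : finType) (u v : vec R I) :
  unit_vector u -> unit_vector v -> braket u v = 0 ->
  orthonormal_family (fun k : 'I_2 => if k == ord0 then u else v).
Proof.
move=> u1 v1 uv0.
have vu0 : braket v u = 0.
  rewrite -[LHS]conjCK -[RHS]conjC0 -uv0; congr (_^*).
  rewrite /braket rmorph_sum; apply: eq_bigr => x _.
  by rewrite rmorphM /= conjCK mulrC.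
by move=> [[|[|//]] ?] [[|[|//]] ?].
Qed.

Lemma braket_basis_state (R : realType) (S : finType) (y : {ffun S -> bool})
    (v : qubits R S) : braket (basis_state R y) v = v y.
Proof.
rewrite /braket (bigD1 y) //= ffunE eqxx conjC1 mul1r big1 ?addr0 // => x xy.
by rewrite ffunE (negPf xy) conjC0 mul0r.
Qed.

(** Schmidt coefficients are nonnegative reals, so the phase of an amplitude must be absorbed into a
    Schmidt vector. *)
Lemma polar_phase (C : numClosedFieldType) (x : C) :
  exists2 z, `|z| = 1 & x = `|x| * z.
Proof.
have [->|x0] := eqVneq x 0; first by exists 1; rewrite ?normr1 // normr0 mul0r.
exists (x / `|x|); first by rewrite normf_div normr_id divff // normr_eq0.
by rewrite mulrC divfK // normr_eq0.
Qed.

Section GGMOfWState.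
Variables (R : realType) (T : finType) (a : T -> R[i]).

Lemma basis_state_restrict (A : {set T}) (x y : {ffun T -> bool}) :
  basis_state R y x =
  basis_state R (restrict (fun i => i \in A) y) (restrict (fun i => i \in A) x) *
  basis_state R (restrict (fun i => i \notin A) y)
                (restrict (fun i => i \notin A) x).
Proof.
rewrite !ffunE; have [->|xy] := eqVneq x y; first by rewrite !eqxx mulr1.
case: eqP => [eA|]; last by rewrite mul0r.
case: eqP => [eB|]; last by rewrite mulr0.
by rewrite (restrict_inj eA eB) eqxx in xy.
Qed.

(** The decomposition is explicit: [|a i0|] times |1> (x) [z] |0...0>, plus [sqrt s] times |0> (x)
    [v1], where [v1] is the normalized W state of the other qubits. Positivity of [s] permits the
    normalization. *)
Lemma schmidt_coefficient_W_state (i0 : T) (s : R) : 0 < s ->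
  s%:C = \sum_(i | i != i0) `|a i| ^+ 2 ->
  schmidt_coefficient [set i0]%SET (W_state a) (Num.sqrt s).
Proof.
move=> s0 sE; have [z z1 az] := polar_phase (a i0).
set A := [set i0]%SET; pose pA := restrict (fun i => i \in A).
pose pB := restrict (fun i => i \notin A).
have sC0 : (Num.sqrt s)%:C != 0 :> R[i].
  by rewrite fmorph_eq0 sqrtr_eq0 -ltNge.
have AE i : (i \notin A) = (i != i0) by rewrite inE.
pose u0 := basis_state R (pA (excited i0)).
pose u1 := basis_state R (pA (vacuum T)).
pose v0 : qubits R _ := [ffun y => z * basis_state R (pB (vacuum T)) y].
pose v1 : qubits R _ := [ffun y =>
  \sum_(i | i \notin A) a i / (Num.sqrt s)%:C * basis_state R (pB (excited i)) y].
(* The modulus lives in [R[i]]; [complex.Re] brings it into [R]. *)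
exists 2%N, (fun k => if k == ord0 then complex.Re `|a i0| else Num.sqrt s).
exists (fun k => if k == ord0 then u0 else u1).
exists (fun k => if k == ord0 then v0 else v1); split; last by exists ord_max.
have normE : (complex.Re `|a i0|)%:C = `|a i0| by rewrite RRe_real // normr_real.
split.
- by move=> k; case: ifP; rewrite ?sqrtr_ge0 // -ler0c normE.
- apply: orthonormal_pair.
  + by rewrite /unit_vector braket_basis_state ffunE eqxx.
  + by rewrite /unit_vector braket_basis_state ffunE eqxx.
  + rewrite braket_basis_state ffunE.
    by rewrite (negPf (@restrict_excited_neq_vacuum _ (fun i => i \in A) i0 _)) ?inE.
- apply: orthonormal_pair.
  + apply/unit_vectorP; rewrite (bigD1 (pB (vacuum T))) //= !ffunE eqxx mulr1 z1.
    rewrite big1 ?addr0 ?expr1n // => y y0.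
    by rewrite !ffunE (negPf y0) mulr0 normr0 expr0n.
  + apply/unit_vectorP; under eq_bigr => y _ do rewrite ffunE.
    rewrite (sum_norm_basis_state (P := fun i => i \notin A)
      (fun i => a i / (Num.sqrt s)%:C) (@restrict_excited_inj _ (fun i => i \notin A))).
    under eq_bigr => i _ do rewrite normf_div expr_div_n.
    rewrite -mulr_suml (eq_bigl _ _ AE) -sE.
    rewrite ger0_norm ?ler0c ?sqrtr_ge0 // -rmorphXn /= sqr_sqrtr ?ltW //.
    by rewrite divff // fmorph_eq0 gt_eqF.
  + rewrite /braket big1 // => y _; rewrite !ffunE.
    have [->|y0] := eqVneq y (pB (vacuum T)); last by rewrite mulr0 conjC0 mul0r.
    rewrite big1 ?mulr0 // => i iA; rewrite ffunE eq_sym.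
    by rewrite (negPf (@restrict_excited_neq_vacuum _ (fun i => i \notin A) i iA)) mulr0.
- move=> x; rewrite big_ord_recl big_ord1 /= normE !ffunE (bigD1 i0) //=.
  congr (_ + _).
    rewrite (basis_state_restrict A) [X in X * _ = _]az.
    rewrite (@restrict_excited_notin _ (fun i => i \notin A)) ?negbK ?inE //.
    by rewrite !ffunE; ring.
  rewrite mulrCA mulr_sumr mulr_sumr (eq_bigl _ _ AE); apply: eq_bigr => i ii0.
  rewrite (basis_state_restrict A) (@restrict_excited_notin _ (fun i => i \in A)) ?inE //.
  by rewrite !ffunE; field.
Qed.

Hypothesis a1 : \sum_i `|a i| ^+ 2 = 1.

Lemma unit_vector_W_state : unit_vector (W_state a).
Proof. by apply/unit_vectorP; rewrite sum_norm_W_state. Qed.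

(** The bipartition of [i0] against the rest has a squared Schmidt coefficient
    [s = 1 - |a i0| ^ 2]. *)
Lemma GGM_W_state_le (i0 : T) : (1 < #|T|)%N -> (GGM (W_state a))%:C <= `|a i0| ^+ 2.
Proof.
move=> T1; set q := `|a i0| ^+ 2.
pose s := complex.Re (\sum_(i | i != i0) `|a i| ^+ 2).
have sum0 : 0 <= \sum_(i | i != i0) `|a i| ^+ 2.
  by apply: sumr_ge0 => i _; rewrite exprn_ge0.
have sE : s%:C = \sum_(i | i != i0) `|a i| ^+ 2 by rewrite RRe_real // ger0_real.
have qE : q = (1 - s)%:C.
  by rewrite rmorphB rmorph1 /= sE -a1 (bigD1 i0) //= addrK.
rewrite qE lecR; apply: le_trans (GGM_le (A := [set i0]%SET) _ _ _) _.
- by apply/finset.set0Pn; exists i0; rewrite inE.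
- by apply: contraTneq T1 => AT; rewrite -cardsT -AT cards1.
(* For [s = 0] the vector [v1] cannot be normalized, but the bound is then just that a square is
   nonnegative. *)
rewrite lerD2l lerN2; move: sum0; rewrite -sE ler0c le_eqVlt => /predU1P[<-|s0].
  by rewrite sqr_ge0.
rewrite -{1}(sqr_sqrtr (ltW s0)) ler_pXn2r ?nnegrE ?largest_schmidt_ge0 ?sqrtr_ge0 //.
apply: largest_schmidt_ge unit_vector_W_state _.
exact: schmidt_coefficient_W_state.
Qed.

(** Each side of a bipartition misses some label, hence a weight of at least [m], so its own weight
    is at most [1 - m]. *)
Lemma GGM_W_state_ge (m : R) : m <= 1 -> (forall i, m%:C <= `|a i| ^+ 2) ->
  m <= GGM (W_state a).
Proof.
move=> m1 ma; apply: GGM_ge => // A A0 AT c c0 cA.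
have sumC (P : pred T) j : ~~ P j -> \sum_(i | P i) `|a i| ^+ 2 <= (1 - m)%:C.
  move=> Pj; rewrite rmorphB rmorph1 /= -a1 [X in _ <= X - _](bigID P) /= -addrA lerDl subr_ge0.
  rewrite (bigD1 j) //=; apply: le_trans (ma j) _.
  by rewrite lerDl sumr_ge0 // => i _; rewrite exprn_ge0.
have [j jA] : exists j, j \notin A.
  apply/existsP; rewrite -negb_forall; apply: contraNN AT => /forallP AT.
  by apply/eqP/setP => i; rewrite inE AT.
have /finset.set0Pn[k kA] := A0.
have sA := sumC (mem A) j jA.
have sB : \sum_(i | i \notin A) `|a i| ^+ 2 <= (1 - m)%:C.
  by apply: (sumC _ k); rewrite negbK.
apply: (schmidt_coefficient_W_state_le c0 cA) => //.
(* What remains is [0 < 1 - m]: the two sides together weigh 1, which is thus at most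
   [2 (1 - m)]. *)
have := a1; rewrite (bigID (mem A)) /= => sAB.
have := lerD sA sB; rewrite sAB -rmorphD -(rmorph1 (real_complex R)) /= lecR.
lra.
Qed.

End GGMOfWState.

(** * Measuring one qubit, and the computational basis as a candidate *)

Section Measurement.
Variables (R : realType) (T : finType) (r : T).
Implicit Types (Phi : qubits R T) (xi : qubit R) (b : bool).

Lemma set_qubit_eq (x : {ffun T -> bool}) b : set_qubit r x b r = b.
Proof. by rewrite ffunE eqxx. Qed.

Lemma set_qubitK (x : {ffun T -> bool}) b c :
  set_qubit r (set_qubit r x b) c = set_qubit r x c.
Proof. by apply/ffunP => i; rewrite !ffunE; case: (i == r). Qed.

Lemma set_qubit_id (x : {ffun T -> bool}) : set_qubit r x (x r) = x.
Proof. by apply/ffunP => i; rewrite !ffunE; case: eqP => [->|]. Qed.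

(* (x, c) |-> (set_qubit x c, x r) is an involution. *)
Lemma sum_set_qubit (F : {ffun T -> bool} -> R[i]) :
  \sum_x \sum_(c : bool) F (set_qubit r x c) = (\sum_x F x) *+ 2.
Proof.
pose h (p : {ffun T -> bool} * bool) := (set_qubit r p.1 p.2, p.1 r).
have hK : involutive h.
  by move=> [x c]; rewrite /h /= set_qubitK set_qubit_id set_qubit_eq.
rewrite pair_big -sumrMnl (reindex h) /=; last exact: onW_bij (inv_bij hK).
rewrite -(pair_big predT predT (fun x c => F (set_qubit r (set_qubit r x c) (x r)))) /=.
by apply: eq_bigr => x _; rewrite big_bool !set_qubitK set_qubit_id.
Qed.

(** The right side is the squared norm of [Phi] contracted with [xi] at [r]. The summand ignores
    [x r], so each labelling of the other qubits is counted twice. This shows that outcome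
    probabilities are real and nonnegative. *)
Lemma braket_project xi Phi :
  braket Phi (project r xi Phi) *+ 2 =
  \sum_x `|\sum_(b : bool) (xi b)^* * Phi (set_qubit r x b)| ^+ 2.
Proof.
rewrite /braket -sum_set_qubit; apply: eq_bigr => x _.
rewrite normCKC rmorph_sum mulr_suml; apply: eq_bigr => c _.
rewrite ffunE set_qubit_eq !mulr_sumr; apply: eq_bigr => b _.
by rewrite set_qubitK rmorphM /= conjCK; ring.
Qed.

Lemma braket_project_ge0 xi Phi : 0 <= braket Phi (project r xi Phi).
Proof.
rewrite -(pmulrn_lge0 _ (ltn0Sn 1)) braket_project.
by apply: sumr_ge0 => x _; rewrite exprn_ge0.
Qed.

Lemma outcome_probE xi Phi :
  (outcome_prob r xi Phi)%:C = braket Phi (project r xi Phi).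
Proof. by rewrite RRe_real // ger0_real // braket_project_ge0. Qed.

Lemma outcome_prob_ge0 xi Phi : 0 <= outcome_prob r xi Phi.
Proof. by rewrite -ler0c outcome_probE braket_project_ge0. Qed.

(** A crude bound suffices, provided it is uniform in [xi]: the coordinates of a unit vector have
    modulus at most 1. It makes the supremum in [LGGM] one of a bounded set. *)
Lemma outcome_prob_bounded Phi :
  exists B : R, forall xi, unit_vector xi -> outcome_prob r xi Phi <= B.
Proof.
pose S := \sum_x (\sum_(b : bool) `|Phi (set_qubit r x b)|) ^+ 2.
have S0 : 0 <= S by apply: sumr_ge0 => x _; rewrite exprn_ge0 // sumr_ge0.
exists (complex.Re S) => xi /unit_vectorP xi1.
rewrite -lecR outcome_probE RRe_real ?ger0_real //.
apply: le_trans (_ : braket Phi (project r xi Phi) *+ 2 <= _).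
  by rewrite mulr2n lerDl braket_project_ge0.
rewrite braket_project; apply: ler_sum => x _.
rewrite ler_pXn2r ?nnegrE ?sumr_ge0 //.
apply: le_trans (ler_norm_sum _ _ _) _; apply: ler_sum => b _.
rewrite normrM norm_conjC ler_piMl // -(expr_le1 (n := 2)) //.
by rewrite -xi1 (bigD1 b) //= lerDl sumr_ge0 // => c _; rewrite exprn_ge0.
Qed.

Lemma measurement_averages_bounded Phi :
  has_ubound (measurement_averages r Phi).
Proof.
have [B PB] := outcome_prob_bounded Phi.
exists (\sum_(l < 2) B) => e [xi [psi [xio _ ->]]]; apply: ler_sum => l _.
apply: le_trans (PB (xi l) _); last by rewrite /unit_vector xio eqxx.
by rewrite ler_piMr ?GGM_le1 ?outcome_prob_ge0.
Qed.

Definition ket b : qubit R := [ffun c => (c == b)%:R].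

Lemma unit_vector_ket b : unit_vector (ket b).
Proof.
apply/unit_vectorP; rewrite (bigD1 b) //= ffunE eqxx normr1 expr1n.
by rewrite big1 ?addr0 // => c cb; rewrite ffunE (negPf cb) normr0 expr0n.
Qed.

Lemma orthonormal_ket :
  orthonormal_family (fun k : 'I_2 => if k == ord0 then ket false else ket true).
Proof.
apply: orthonormal_pair; rewrite ?unit_vector_ket //.
  exact: unit_vector_ket.
  exact: unit_vector_ket.
by rewrite /braket big_bool !ffunE /= conjC0 mul0r mulr0 addr0.
Qed.

(** [insub i] fails exactly at [i = r], where the default [b] is taken. *)
Definition extend b (y : {ffun {i : T | i != r} -> bool}) : {ffun T -> bool} :=
  [ffun i => oapp y b (insub i)].

Lemma extend_r b y : extend b y r = b.
Proof. by rewrite ffunE insubF ?eqxx. Qed.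

Lemma extend_val b y j : extend b y (val j) = y j.
Proof. by rewrite ffunE valK. Qed.

Lemma extendK b : cancel (extend b) (restrict (fun i => i != r)).
Proof. by move=> y; apply/ffunP => j; rewrite ffunE extend_val. Qed.

Lemma restrictK b (x : {ffun T -> bool}) :
  x r = b -> extend b (restrict (fun i => i != r) x) = x.
Proof.
move=> xr; apply/ffunP => i; have [->|ir] := eqVneq i r.
  by rewrite extend_r xr.
by have /= -> := extend_val b (restrict _ x) (exist (fun i => i != r) i ir); rewrite ffunE.
Qed.

Lemma sum_extend b (F : {ffun T -> bool} -> R[i]) :
  \sum_(x : {ffun T -> bool} | x r == b) F x = \sum_y F (extend b y).
Proof.
rewrite (reindex_onto (extend b) (restrict (fun i => i != r))).
  by apply: eq_bigl => y; rewrite extend_r extendK !eqxx.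
by move=> x /eqP; apply: restrictK.
Qed.

Lemma project_ket b Phi x :
  project r (ket b) Phi x = (x r == b)%:R * Phi x.
Proof.
rewrite ffunE (bigD1 b) //= big1 ?addr0; last first.
  by move=> c cb; rewrite !ffunE (negPf cb) conjC0 mulr0 mul0r.
rewrite !ffunE eqxx conjC1 mulr1; case: eqP => [<-|]; last by rewrite !mul0r.
by rewrite set_qubit_id.
Qed.

Lemma outcome_prob_ket b Phi :
  (outcome_prob r (ket b) Phi)%:C = \sum_y `|Phi (extend b y)| ^+ 2.
Proof.
rewrite outcome_probE -(sum_extend b (fun x => `|Phi x| ^+ 2)) /braket.
rewrite [RHS]big_mkcond; apply: eq_bigr => x _.
rewrite project_ket normCKC; case: eqP => _; first by rewrite mul1r.
by rewrite mul0r mulr0.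
Qed.

(** At probability 0, division by 0 yields the zero vector, and its term in the average has factor
    0. *)
Definition ket_post b Phi : qubits R {i : T | i != r} :=
  [ffun y => Phi (extend b y) / (Num.sqrt (outcome_prob r (ket b) Phi))%:C].

Lemma post_measurement_ket b Phi : 0 < outcome_prob r (ket b) Phi ->
  post_measurement (ket b) Phi (ket_post b Phi).
Proof.
move=> p0; split; last first.
  move=> x; rewrite project_ket !ffunE; case: eqP => [/restrictK ->|_].
    by rewrite !mul1r.
  by rewrite !mul0r.
apply/unit_vectorP; under eq_bigr => y _ do rewrite ffunE normf_div expr_div_n.
rewrite -mulr_suml -outcome_prob_ket ger0_norm ?ler0c ?sqrtr_ge0 //.
by rewrite -rmorphXn /= sqr_sqrtr ?ltW // divff // fmorph_eq0 gt_eqF.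
Qed.

Lemma LGGM_ge Phi :
  \sum_(b : bool) outcome_prob r (ket b) Phi * GGM (ket_post b Phi) <= LGGM r Phi.
Proof.
apply: ub_le_sup; first exact: measurement_averages_bounded.
exists (fun k => if k == ord0 then ket false else ket true).
exists (fun k => if k == ord0 then ket_post false Phi else ket_post true Phi).
split; first exact: orthonormal_ket.
  by move=> k; case: ifP => _; apply: post_measurement_ket.
by rewrite big_bool big_ord_recl big_ord1 addrC.
Qed.

(** Outcome 0 at [r] removes the amplitude [a r], since [extend false y] is never [excited r], and
    keeps all the others. *)
Lemma W_state_extend (a : T -> R[i]) y :
  W_state a (extend false y) = W_state (fun j : {i : T | i != r} => a (val j)) y.
Proof.
have yr : extend false y != excited r.
  by apply/eqP => /ffunP /(_ r); rewrite extend_r !ffunE eqxx.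
rewrite !ffunE (bigD1 r) //= ffunE (negPf yr) mulr0 add0r.
rewrite (big_sub (fun i => i != r)); apply: eq_bigr => j _.
rewrite !ffunE; congr (_ * (nat_of_bool _)%:R).
rewrite -(inj_eq (can_inj (extendK false))); congr (_ == _).
apply/ffunP => i; have [->|ir] := eqVneq i r.
  by rewrite extend_r ffunE eq_sym (negPf (valP j)).
by have /= -> := extend_val false (excited j) (exist (fun i => i != r) i ir); rewrite !ffunE.
Qed.

End Measurement.

(** * Comparison of the LGGM and the GGM *)

Theorem proposition3 (R : realType) (N : nat) (hN : (3 <= N)%N)
    (a : 'I_N -> R[i]) (ha : \sum_(i < N) `|a i| ^+ 2 = 1) (r : 'I_N) :
  LGGM r (generalized_W a) >= GGM (generalized_W a).
Proof.
have -> : generalized_W a = W_state a by [].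
set m := GGM _; set Phi := W_state a.
have ma i : m%:C <= `|a i| ^+ 2.
  by apply: GGM_W_state_le; rewrite // card_ord (leq_trans _ hN).
pose p b := outcome_prob r (ket R b) Phi.
have p_ge0 b : 0 <= p b by apply: outcome_prob_ge0.
have term_ge0 b : 0 <= p b * GGM (ket_post r b Phi).
  have := p_ge0 b; rewrite le_eqVlt => /predU1P[<-|pb]; first by rewrite mul0r.
  by rewrite mulr_ge0 // GGM_ge0 //; have [] := post_measurement_ket pb.
apply: le_trans (LGGM_ge r Phi); rewrite big_bool -/(p true) -/(p false).
(* Outcome 1 contributes a nonnegative term and is dropped. *)
apply: ler_wpDl => //.
have pE : (p false)%:C = \sum_(j : {i | i != r}) `|a (val j)| ^+ 2.
  rewrite /p outcome_prob_ket.
  rewrite -(sum_norm_W_state (fun j : {i | i != r} => a (val j))); apply: eq_bigr => y _.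
  by rewrite W_state_extend.
have /card_gt0P[j0 j0r] : (0 < #|predC1 r|)%N.
  by rewrite cardC1 card_ord -subn1 subn_gt0 (leq_trans _ hN).
(* The probability of outcome 0 contains the weight of some [j0 != r]. This settles the case
   [p false = 0] and later gives [m / p false <= 1]. *)
have mp : m <= p false.
  rewrite -lecR pE (bigD1 (exist (fun i => i != r) j0 j0r)) //=.
  apply: le_trans (ma j0) _.
  by rewrite lerDl sumr_ge0 // => i _; rewrite exprn_ge0.
have := p_ge0 false; rewrite le_eqVlt => /predU1P[p0|p0].
  by rewrite -p0 mul0r p0.
(* It remains to bound the GGM after outcome 0 below by [m / p false]; the renormalized amplitudes
   have squared moduli [|a j| ^ 2 / p false]. *)
rewrite mulrC -ler_pdivrMr //.
set s := (Num.sqrt (p false))%:C; have sE : `|s| ^+ 2 = (p false)%:C.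
  by rewrite ger0_norm ?ler0c ?sqrtr_ge0 // -rmorphXn /= sqr_sqrtr // ltW.
have -> : ket_post r false Phi = W_state (fun j : {i | i != r} => a (val j) / s).
  apply/ffunP => y; rewrite ffunE W_state_extend !ffunE mulr_suml.
  by apply: eq_bigr => j _; rewrite -/(p false) -/s; ring.
apply: GGM_W_state_ge.
- under eq_bigr => j _ do rewrite normf_div expr_div_n.
  by rewrite -mulr_suml sE -pE divff // fmorph_eq0 gt_eqF.
- by rewrite ler_pdivrMr // mul1r.
- move=> j; rewrite normf_div expr_div_n sE fmorph_div /=.
  by rewrite ler_pM2r ?ma // invr_gt0 ltcR.
Qed.
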